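(* Let \(\lambda\in\mathbb R\setminus\mathbb Q\), and choose \(L\in\mathbb N\) with \(L\|\sqrt2\|_{\mathbb T}>1+|\lambda|\). Define \(h_1(t)=t^{3/2}\), \(h_2(t)=\lambda t^{3/2}+L(t+\sqrt2)\), and \(h_3(t)=t^2\). Then \(\mathcal P_{\mathbb Z}(h_1,h_2,h_3)=\{ct^2: c\in\mathbb Z,\ c\neq 0\}\), and hence \(\mathcal P_{\mathbb Z}(h_1,h_2,h_3)\) is jointly intersective. Nevertheless, there exists \(E\subset\mathbb N\) of positive natural density such that \(R^{[\cdot]}_{h_1}(E)\cap R^{[\cdot]}_{h_2}(E)\cap R^{[\cdot]}_{h_3}(E)=\varnothing\).
   Context: \(\mathbb N=\{1,2,\ldots\}\). For \(x\in\mathbb R\), \(\|x\|_{\mathbb T}=\min_{m\in\mathbb Z}|x-m|\), and \([x]\) denotes a closest integer to \(x\). For real-valued functions \(f_1,\ldots,f_k\), let \(\mathrm{span}^*(f_1,\ldots,f_k)=\{\sum_{i=1}^k c_if_i: (c_1,\ldots,c_k)\in\mathbb R^k\setminus\{0\}\}\), and let \(\mathcal P_{\mathbb Z}(f_1,\ldots,f_k)\) be the set of all \(q\in\mathbb Z[t]\) for which there exists \(f\in\mathrm{span}^*(f_1,\ldots,f_k)\) with \(|f(t)-q(t)|\to 0\) as \(t\to\infty\). A collection \(\mathcal Q\subset\mathbb Z[t]\) is jointly intersective if for every \(m\in\mathbb N\) there exists \(n\in\mathbb N\) with \(q(n)\equiv 0\pmod m\) for all \(q\in\mathcal Q\). For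 \(E\subset\mathbb N\), \(r\in\mathbb Z\), \(E-r=\{m\in\mathbb N:m+r\in E\}\), and \(R^{[\cdot]}_f(E)=\{n\in\mathbb N: E\cap(E-[f(n)])\neq\varnothing\}\). Natural density: \(d(E)=\lim_{N\to\infty}|E\cap\{1,\ldots,N\}|/N\) when it exists. *)

(* Defs.v *)
From HB Require Import structures.
From mathcomp Require Import all_boot all_order all_algebra.
From mathcomp Require Import all_classical all_reals all_analysis.
From mathcomp Require Import lra.
Set Implicit Arguments.
Unset Strict Implicit.
Unset Printing Implicit Defensive.
Import Order.TTheory GRing.Theory Num.Theory.
Import numFieldNormedType.Exports.
Local Open Scope classical_set_scope.
Local Open Scope ring_scope.

(* [nat] contains 0, whereas the positive integers {1, 2, ...} are meant
   throughout: the side conditions [(0 < n)%N] below account for this. *)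
Definition posnat : set nat := [set n | (0 < n)%N].

(* The infimum is a minimum: see [normT_min]. *)
Definition normT (R : realType) (x : R) : R :=
  inf [set `|x - m%:~R| | m in [set: int]].

(* [rnd] selects, for every x, one of the (at most two) integers closest to x;
   no convention on ties is imposed. *)
Definition is_closest_integer (R : realType) (rnd : R -> int) : Prop :=
  forall (x : R) (m : int), `|x - (rnd x)%:~R| <= `|x - m%:~R|.

Definition span_star (R : realType) (k : nat) (fs : k.-tuple (R -> R)) :
    set (R -> R) :=
  [set f | exists c : 'rV[R]_k,
     c != 0 /\ f = fun t => \sum_(i < k) c ord0 i * tnth fs i t].

Definition PZ (R : realType) (k : nat) (fs : k.-tuple (R -> R)) :
    set {poly int} :=
  [set q | exists f : R -> R, span_star fs f /\
     `|f t - (map_poly intr q).[t]| @[t --> +oo] --> (0 : R)].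

Definition jointly_intersective (Q : set {poly int}) : Prop :=
  forall m : nat, (0 < m)%N -> exists n : nat, (0 < n)%N /\
    forall q : {poly int}, Q q -> (q.[n%:Z] = 0 %[mod m%:Z])%Z.

Definition shift_set (E : set nat) (r : int) : set nat :=
  [set m | (0 < m)%N /\ exists2 e : nat, E e & e%:Z = m%:Z + r].

Definition return_set (R : realType) (rnd : R -> int) (f : R -> R)
    (E : set nat) : set nat :=
  [set n | (0 < n)%N /\ E `&` shift_set E (rnd (f n%:R)) !=set0].

Definition has_natural_density (R : realType) (E : set nat) (d : R) : Prop :=
  (count (fun k => k \in E) (iota 1 N))%:R / N%:R @[N --> \oo] --> d.

Definition h1 (R : realType) (t : R) : R := t `^ (3 / 2).

Definition h2 (R : realType) (lambda : R) (L : nat) (t : R) : R :=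
  lambda * t `^ (3 / 2) + L%:R * (t + Num.sqrt 2).

Definition h3 (R : realType) (t : R) : R := t ^+ 2.

Lemma closest_integer_exists (R : realType) :
  exists rnd : R -> int, is_closest_integer rnd.
Proof.
exists (fun x => Num.floor (x + 2^-1)) => x m.
have /andP[f1 f2] := real_floor_itv (num_real (x + 2^-1)).
move: f1 f2; rewrite rmorphD/= => f1 f2.
have [->//|neq] := eqVneq m (Num.floor (x + 2^-1)).
set r := Num.floor _ in f1 f2 neq *.
have h : `|x - r%:~R| <= 2^-1 by rewrite ler_norml; apply/andP; split; lra.
apply: (le_trans h); have [mr|rm|/eqP] := ltgtP m r; last by rewrite (negPf neq).
  have : (m + 1)%:~R <= r%:~R :> R by rewrite ler_int lezD1.
  by rewrite rmorphD/= => ?; rewrite ler_normr; apply/orP; left; lra.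
have : (r + 1)%:~R <= m%:~R :> R by rewrite ler_int lezD1.
by rewrite rmorphD/= => ?; rewrite ler_normr; apply/orP; right; lra.
Qed.

Lemma normT_min (R : realType) (x : R) :
  exists m : int, normT x = `|x - m%:~R| /\
    forall k : int, `|x - m%:~R| <= `|x - k%:~R|.
Proof.
have [rnd rndP] := closest_integer_exists R.
exists (rnd x); split; last exact: rndP.
apply/le_anti/andP; split.
  by apply: ge_inf; [exists 0 => _ [k _ <-]|exists (rnd x)].
apply: lb_le_inf; first by exists `|x - (rnd x)%:~R|, (rnd x).
by move=> _ [k _ <-]; exact: rndP.
Qed.

(* Main.v *)
Require Import Defs.
From HB Require Import structures.
From mathcomp Require Import all_boot all_order all_algebra.
From mathcomp Require Import all_classical all_reals all_analysis.
From mathcomp Require Import ring lra zify polyrcf.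
Import Order.TTheory GRing.Theory Num.Theory.
Import numFieldNormedType.Exports.
Local Open Scope classical_set_scope.
Local Open Scope ring_scope.

(** Substituting t = s^2 turns a combination of h1, h2, h3 minus a polynomial
    into a polynomial in s, which tends to 0 only if it vanishes; comparing
    coefficients and using the irrationality of sqrt 2 leaves only c t^2.

    For the counterexample, note that [h2(n)] - lambda [h1(n)] equals
    L (n + sqrt 2) up to an error at most (1 + |lambda|) / 2.  If both roundings
    are multiples of L, say L u2 and L u1, and u1 lambda is within
    |sqrt 2|_T / 2 of an integer, then dividing by L brings sqrt 2 closer to an
    integer than |sqrt 2|_T, a contradiction.  So it suffices
    that E consists of multiples L k with k lambda in a short arc of the circle.
    Taking the arc length to be the fractional part of j lambda (or of
    - j lambda) for a suitable j, its indicator is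
    floor ((k + j) lambda) - floor (k lambda) - floor (j lambda), so that the
    counting function telescopes and the density exists without appeal to
    Weyl's equidistribution theorem. *)

(** * Floors and Dirichlet approximation *)

Lemma floor_le_lt {R : realType} (x : R) :
  (Num.floor x)%:~R <= x /\ x < (Num.floor x)%:~R + 1.
Proof. by have /andP[] := floor_itv x; rewrite intrD. Qed.

Lemma irrational_mulrn_neq_int {R : realType} (x : R) (j : nat) (p : int) :
  irrational x -> (0 < j)%N -> j%:R * x != p%:~R.
Proof.
move=> xirr j0; apply/eqP => xE; apply: xirr; exists (p%:Q / j%:Q) => //.
have j0' : j%:R != 0 :> R by rewrite pnatr_eq0 -lt0n.
by rewrite fmorph_div !rmorph_int -xE -pmulrn mulrC mulKf.
Qed.

(** Pigeonhole: two of the [Q.+2] fractional parts of [k x] share one of [Q.+1] boxes of width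
    [1 / Q.+1 < eps]. Irrationality makes the distance nonzero. *)
Lemma Dirichlet_approximation {R : realType} (x eps : R) :
  irrational x -> 0 < eps ->
  exists (j : nat) (p : int), (0 < j)%N /\ 0 < `|j%:R * x - p%:~R| < eps.
Proof.
move=> xirr eps0.
suff [j [p [j0 jp]]] : exists (j : nat) (p : int),
    (0 < j)%N /\ `|j%:R * x - p%:~R| < eps.
  exists j, p; split=> //; rewrite jp andbT normr_gt0 subr_eq0.
  exact: irrational_mulrn_neq_int.
pose Q := Num.truncn eps^-1; have Q1 : 1 / Q.+1%:R < eps.
  rewrite div1r invf_plt ?posrE ?ltr0n// /Q.
  exact: truncnS_gt.
pose fl (k : nat) := Num.floor (k%:R * x).
pose u (k : nat) := k%:R * x - (fl k)%:~R.
have ub k : 0 <= u k /\ u k < 1.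
  by have [? ?] := floor_le_lt (k%:R * x); rewrite /u /fl; split; lra.
have Q0 : 0 < Q.+1%:R :> R by rewrite ltr0n.
have vlt k : (Num.truncn (u k * Q.+1%:R) < Q.+1)%N.
  have [u0 u1] := ub k.
  rewrite truncn_lt_nat ?mulr_ge0// ?ltW//; nra.
pose v (k : 'I_Q.+2) := Ordinal (vlt k).
have /injectivePn[i [k ik vik]] : ~~ injectiveb v.
  apply/negP => /injectiveP/leq_card; rewrite !card_ord; lia.
wlog lt_ik : i k ik vik / (i < k)%N => [H|].
  have [lt|lt|/val_inj eq] := ltngtP i k; first exact: (H i k).
    by apply: (H k i) => //; rewrite eq_sym.
  by rewrite eq eqxx in ik.
exists (k - i)%N, (fl k - fl i); split; first by rewrite subn_gt0.
rewrite natrB 1?ltnW// intrB.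
have -> : (k%:R - i%:R) * x - ((fl k)%:~R - (fl i)%:~R) = u k - u i.
  by rewrite /u; ring.
apply: lt_trans Q1; rewrite ltr_pdivlMr//.
move: vik => /(congr1 val)/= vik.
have [ui0 _] := ub i; have [uk0 _] := ub k.
have /andP[+ +] := truncn_itv (mulr_ge0 ui0 (ltW Q0)).
have /andP[+ +] := truncn_itv (mulr_ge0 uk0 (ltW Q0)).
rewrite -vik -natr1 => *.
by rewrite -[X in _ * X]gtr0_norm// -normrM ltr_norml; apply/andP; split; lra.
Qed.

(** * Return times to an arc and their density *)

(* When t = j x - p lies in [0, 1), this says that the fractional part of k x
   lies in [1 - t, 1). *)
Definition return_times {R : realType} (x : R) (j : nat) (p : int) (k : nat) :=
  Num.floor ((k + j)%N%:R * x) == Num.floor (k%:R * x) + p + 1.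

Definition dilated_return_times {R : realType} (L : nat) (x : R) (j : nat)
    (p : int) : set nat :=
  [set m | [&& (0 < m)%N, (L %| m)%N & return_times x j p (m %/ L)]].

(** Both fractional parts lie in one half-open interval of length [j x - p], so [w] can be the
    difference of the two floors. *)
Lemma return_times_diff {R : realType} (x : R) (j : nat) (p : int) (k l : nat) :
  return_times x j p k -> return_times x j p l ->
  exists w : int, `|(k%:R - l%:R) * x - w%:~R| < j%:R * x - p%:~R.
Proof.
rewrite /return_times => /eqP kE /eqP lE.
have [+ _] := floor_le_lt ((k + j)%N%:R * x).
have [+ _] := floor_le_lt ((l + j)%N%:R * x).
rewrite kE lE !intrD !natrD.
have [_ +] := floor_le_lt (k%:R * x); have [_ +] := floor_le_lt (l%:R * x).
move=> *; exists (Num.floor (k%:R * x) - Num.floor (l%:R * x)).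
rewrite intrB ltr_norml; apply/andP; split; lra.
Qed.

(** Adding [j x - p] in [0, 1) to a fractional part carries at most 1; the indicator is that
    carry. *)
Lemma return_timesE {R : realType} (x : R) (j : nat) (p : int) (k : nat) :
  0 <= j%:R * x - p%:~R < 1 ->
  (return_times x j p k : nat)%:Z =
    Num.floor ((k + j)%N%:R * x) - Num.floor (k%:R * x) - p.
Proof.
move=> /andP[t0 t1]; rewrite /return_times.
have [a1 a2] := floor_le_lt ((k + j)%N%:R * x).
have [b1 b2] := floor_le_lt (k%:R * x).
move: a1 a2 b1 b2; set a := Num.floor _; set b := Num.floor _.
rewrite natrD => a1 a2 b1 b2.
have : (b + p - 1)%:~R < a%:~R :> R by rewrite !intrD ?intrN; lra.
have : a%:~R < (b + p + 2)%:~R :> R by rewrite !intrD; lra.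
rewrite !ltr_int; case: eqP => /=; lia.
Qed.

(* By [return_timesE] the indicator is a coboundary, so the count telescopes. *)
Lemma count_dilated_return_times {R : realType} (L : nat) (x : R) (j : nat)
    (p : int) (N : nat) :
  (0 < L)%N -> 0 <= j%:R * x - p%:~R < 1 ->
  (count (fun k => k \in dilated_return_times L x j p) (iota 1 N))%:Z =
  \sum_(i < j) Num.floor ((N %/ L + i.+1)%N%:R * x)
  - \sum_(i < j) Num.floor (i.+1%:R * x) - p *+ (N %/ L).
Proof.
move=> L0 t01; elim: N => [|N IH].
  by rewrite div0n mulr0n subr0 /=; under eq_bigr do rewrite add0n; rewrite subrr.
rewrite -{1}[N.+1]addn1 iotaD count_cat PoszD IH /= addn0 add1n divnS//.
case: (boolP (L %| N.+1)%N) => [dvdL|ndvdL]; last first.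
  rewrite add0n (_ : N.+1 \in _ = false) ?addr0//.
  by apply/negbTE; rewrite notin_setE => /and3P[_]; rewrite (negbTE ndvdL).
have -> : N.+1 \in dilated_return_times L x j p =
    return_times x j p (N %/ L).+1.
  (* [divnS] gives the quotient of [N.+1] as the boolean [L %| N.+1] plus [N %/ L], hence the detour
     through [true]. *)
  rewrite -[(N %/ L).+1]/(true + N %/ L)%N -[in RHS]dvdL -divnS//.
  apply/idP/idP => [|rt]; first by rewrite inE => /and3P[].
  by rewrite inE; apply/and3P; split.
rewrite return_timesE// add1n.
(* The quotient grows by one, so the window of [j] floors shifts: one term enters at the top and one
   leaves at the bottom. The window is empty for [j = 0]. *)
case: j {IH} t01 => [|j] t01.
  by rewrite !big_ord0 [p *+ _.+1]mulrS addn0; ring.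
rewrite [in RHS]big_ord_recr/= [in LHS]big_ord_recl/=.
under [in RHS]eq_bigr do rewrite addSnnS.
by rewrite [p *+ _.+1]mulrS addn1; ring.
Qed.

Lemma cvg_of_bounded_discrepancy {R : realType} (c : nat -> R) (d B : R) :
  (forall N, `|c N - N%:R * d| <= B) -> c N / N%:R @[N --> \oo] --> d.
Proof.
move=> cB; apply/cvgrPdist_le => eps eps0.
have B0 : 0 <= B by apply: le_trans (cB 0%N).
near=> N.
have N0 : 0 < N%:R :> R by rewrite ltr0n; near: N; exact: nbhs_infty_gt.
have NB : B / eps <= N%:R by near: N; exact: nbhs_infty_ger.
have -> : d - c N / N%:R = - (c N - N%:R * d) / N%:R.
  by field; rewrite gt_eqF.
rewrite normrM normrN normfV (gtr0_norm N0) ler_pdivrMr//.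
by apply: le_trans (cB N) _; rewrite mulrC -ler_pdivrMr.
Unshelve. all: by end_near.
Qed.

(** Each floor in the telescoped count is within 1 of its argument, so the count differs from [N]
    times the density by a bounded amount. *)
Lemma natural_density_dilated_return_times {R : realType} (L : nat) (x : R)
    (j : nat) (p : int) :
  (0 < L)%N -> 0 <= j%:R * x - p%:~R < 1 ->
  has_natural_density (dilated_return_times L x j p)
    ((j%:R * x - p%:~R) / L%:R).
Proof.
move=> L0 t01; have /andP[t0 t1] := t01; rewrite /has_natural_density.
pose S (M : nat) : int := \sum_(i < j) Num.floor ((M + i.+1)%N%:R * x).
pose D : R := \sum_(i < j) i.+1%:R * x.
have SM M : `|(S M)%:~R - M%:R * (j%:R * x) - D| <= j%:R.
  have -> : (S M)%:~R - M%:R * (j%:R * x) - D =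
      \sum_(i < j) ((Num.floor ((M + i.+1)%N%:R * x))%:~R - (M + i.+1)%N%:R * x).
    rewrite /S rmorph_sum/= sumrB -addrA -opprD; congr (_ - _).
    under [RHS]eq_bigr do rewrite natrD mulrDl.
    by rewrite big_split/= sumr_const card_ord -/D; ring.
  apply: le_trans (ler_norm_sum _ _ _) _.
  rewrite -[leRHS]mulr1 mulr_natl -[X in _ *+ X]card_ord -sumr_const.
  apply: ler_sum => i _.
  have [? ?] := floor_le_lt ((M + i.+1)%N%:R * x).
  by rewrite ler_norml; apply/andP; split; lra.
apply: (@cvg_of_bounded_discrepancy _ _ _
  (* The terms bound the floor errors, the two offsets independent of [N], and the effect of
     replacing [N / L] by its integer part. *)
  (j%:R + `|D| + `|(\sum_(i < j) Num.floor (i.+1%:R * x))%:~R| + 1)) => N.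
rewrite pmulrn (count_dilated_return_times L x j p N L0 t01).
set K := \sum_(i < j) Num.floor (i.+1%:R * x).
rewrite -/(S (N %/ L)%N); have := SM (N %/ L)%N.
rewrite !intrB rmorphMn/= -[p%:~R *+ _]mulr_natr; set M := (N %/ L)%N.
have L0' : 0 < L%:R :> R by rewrite ltr0n.
pose r : R := (N %% L)%N%:R / L%:R.
have r0 : 0 <= r by rewrite divr_ge0.
have r1 : r <= 1 by rewrite ler_pdivrMr// mul1r ler_nat ltnW// ltn_mod.
have -> : N%:R * ((j%:R * x - p%:~R) / L%:R) = (M%:R + r) * (j%:R * x - p%:~R).
  rewrite {1}(divn_eq N L) -/M natrD natrM /r; field.
  by rewrite gt_eqF.
set th := j%:R * x - p%:~R in t0 t1 *.
have -> : (S M)%:~R - K%:~R - p%:~R * M%:R - (M%:R + r) * th =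
  ((S M)%:~R - M%:R * (j%:R * x) - D) + D - K%:~R - r * th by rewrite /th; ring.
have rt : `|r * th| <= 1 by rewrite ger0_norm ?mulr_ge0// mulr_ile1// ltW.
set Z := _ - D => ZB.
apply: le_trans (ler_normB _ _) _; apply: lerD => //.
apply: le_trans (ler_normB _ _) _; apply: lerD => //.
by apply: le_trans (ler_normD _ _) _; apply: lerD.
Qed.

(** * Polynomials approximated by combinations of [h1], [h2], [h3] *)

(** Up to sign the leading coefficient is positive, and then the values are eventually at least that
    coefficient, even for a constant polynomial. *)
Lemma poly_small_at_pinfty {R : realType} (P : {poly R}) :
  (forall eps, 0 < eps -> exists A, forall s, A < s -> `|P.[s]| < eps) -> P = 0.
Proof.
move=> small; apply/eqP; rewrite -lead_coef_eq0; apply/negPn/negP => lc0.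
have [A AP] := small `|lead_coef P| (ltac:(by rewrite normr_gt0)).
wlog lc_gt0 : P small lc0 AP / 0 < lead_coef P => [H|].
  have [|lt0|/eqP] := ltgtP 0 (lead_coef P); first exact: (H P).
    apply: (H (- P)); rewrite ?lead_coefN ?oppr_eq0 ?oppr_gt0 ?normrN//.
      by move=> e /small[B BP]; exists B => s /BP; rewrite hornerN normrN.
    by move=> s /AP; rewrite hornerN normrN.
  by rewrite eq_sym (negbTE lc0).
have [n nP] := poly_pinfty_gt_lc lc_gt0.
pose s := Num.max n (A + 1).
have := AP s; rewrite lt_max ltrDl ltr01 orbT => /(_ isT).
have := nP s; rewrite le_max lexx => /(_ isT) le_lc.
by rewrite (gtr0_norm lc_gt0) gtr0_norm 1?(lt_le_trans lc_gt0)// ltNge le_lc.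
Qed.

(** If [m] were nonzero, the exponent of 2 would be odd in [2 m^2] and even in [n^2]. *)
Lemma sqrt2_mul_int {R : realType} (m n : int) :
  m%:~R * Num.sqrt 2 = n%:~R :> R -> m = 0.
Proof.
move=> /(congr1 (fun z => z ^+ 2)); rewrite exprMn sqr_sqrtr// => mn.
have {}mn : m ^+ 2 * 2 = n ^+ 2.
  by apply: (@intr_inj R); rewrite intrM !rmorphXn.
have [//|m0] := eqVneq m 0; exfalso.
have n0 : n != 0.
  apply: contra_neq m0 => n0; move/eqP: mn.
  by rewrite n0 expr0n/= mulf_eq0 expf_eq0/= orbF => /eqP.
have /(congr1 (logn 2)) : (`|m| ^ 2 * 2 = `|n| ^ 2)%N.
  by rewrite -!abszX -mn abszM.
rewrite lognM ?expn_gt0 ?absz_gt0 ?m0// !lognX (pfactorK 1 (isT : prime 2)); lia.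
Qed.

Lemma span_star3E {R : realType} (f g h : R -> R) (F : R -> R) :
  span_star [tuple f; g; h] F <->
  exists a b c : R, (a, b, c) != (0, 0, 0) /\
    F = fun t => a * f t + b * g t + c * h t.
Proof.
have sumE (v : 'rV[R]_3) t : \sum_(i < 3) v ord0 i * tnth [tuple f; g; h] i t =
    v ord0 0 * f t + v ord0 1 * g t + v ord0 2%:R * h t.
  rewrite !big_ord_recl big_ord0 addr0 addrA.
  by rewrite !(tnth_nth f)/=; congr (v _ _ * _ + v _ _ * _ + v _ _ * _);
    apply/val_inj.
split=> [[v [v0 ->]]|[a [b [c [abc0 ->]]]]].
  exists (v ord0 0), (v ord0 1), (v ord0 2%:R); split; last first.
    by apply/funext => t; rewrite sumE.
  apply: contra_neq v0 => -[v0 v1 v2]; apply/rowP => i; rewrite mxE.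
  case: i => -[|[|[|//]]] i3; [rewrite -v0|rewrite -v1|rewrite -v2];
    by congr (v _ _); apply/val_inj.
exists (\row_i nth 0 [:: a; b; c] i); split; last first.
  by apply/funext => t; rewrite sumE !mxE.
apply: contra_neq abc0 => /rowP v0.
by have := (v0 0, v0 1, v0 2%:R); rewrite !mxE /= => -[[-> ->] ->].
Qed.

Lemma PZ_h1_h2_h3 {R : realType} (lambda : R) (L : nat) : (0 < L)%N ->
  PZ [tuple (@h1 R); h2 lambda L; (@h3 R)] =
    [set q : {poly int} | exists c : int, c != 0 /\ q = c *: 'X^2].
Proof.
move=> L0; apply/seteqP; split=> q /=; last first.
  move=> [c [c0 ->]]; exists (fun t => c%:~R * h3 t); split.
    apply/span_star3E; exists 0, 0, c%:~R; split.
      by apply: contra_neq c0 => -[] /eqP; rewrite intr_eq0 => /eqP.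
    by apply/funext => t; rewrite !mul0r !add0r.
  rewrite (_ : (fun t => _) = cst 0); first exact: cvg_cst.
  apply/funext => t; rewrite map_polyZ/= map_polyXn hornerZ hornerXn /h3.
  by rewrite subrr normr0.
move=> [F [/span_star3E[a [b [c [abc0 ->]]]] cvgF]].
pose qR : {poly R} := map_poly intr q.
(* Substituting t = s^2 turns the difference into a polynomial in s. *)
pose P : {poly R} := (a + b * lambda) *: 'X^3 + (b * L%:R) *: 'X^2 +
  (b * L%:R * Num.sqrt 2)%:P + c *: 'X^4 - (qR \Po 'X^2).
have P0 : P = 0.
  apply: poly_small_at_pinfty => eps eps0.
  move/cvgr0Pnorm_lt/(_ _ eps0) : cvgF => [A [_ AP]].
  exists (Num.max 1 A) => s; rewrite gt_max => /andP[s1 sA].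
  have s0 : 0 <= s by lra.
  have := AP (s ^+ 2) (ltac:(nra)); rewrite /= normr_id; congr (`|_| < _).
  have s3 : (s ^+ 2) `^ (3 / 2) = s ^+ 3.
    rewrite -powR_mulrn// -powRrM -powR_mulrn//; congr (_ `^ _).
    by field.
  rewrite /P !hornerD hornerN horner_comp hornerC !hornerZ !hornerXn /h1 /h2 /h3 s3 -/qR.
  by ring.
have Pc i : P`_i = 0 by rewrite P0 coef0.
(* The composite with ['X^2] has no odd coefficients, so only [h1] and [h2] contribute in degree
   3. *)
have e3 : a + b * lambda = 0.
  move: (Pc 3%N); rewrite /P !coefB !coefD !coefZ coefC !coefXn.
  by rewrite coef_comp_poly_Xn//= !mulr0 mulr1 subr0 !addr0.
have ev (i : nat) : b * L%:R * (i == 1)%:R + b * L%:R * Num.sqrt 2 * (i == 0)%:R +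
    c * (i == 2)%:R = (q`_i)%:~R.
  apply/eqP; rewrite -subr_eq0 -[X in _ == X](Pc (i * 2)%N).
  rewrite /P !coefB !coefD !coefZ coefC !coefXn coef_comp_poly_Xn//.
  rewrite dvdn_mull// mulnK// coef_map/= e3 mul0r add0r.
  by case: i => [|[|[|i]]] /=; rewrite ?(mulr0, mulr1, addr0, add0r).
have := (ev 0%N, ev 1%N, ev 2%N) => {P P0 Pc} -[[]] /=.
rewrite !mulr0 !mulr1 !addr0 !add0r => e0 e1 e2.
(* Here [b L] is the integer [q]_1[, while its product with the square root of 2 is the
   integer]q[_0]. *)
have q1 : q`_1 = 0 by apply: (@sqrt2_mul_int R _ q`_0); rewrite -e1.
have L0' : L%:R != 0 :> R by rewrite pnatr_eq0 -lt0n.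
have b0 : b = 0 by apply: (mulIf L0'); rewrite mul0r e1 q1.
have a0 : a = 0 by rewrite b0 mul0r addr0 in e3.
exists q`_2; split.
  by apply: contra_neq abc0 => q2; rewrite a0 b0 e2 q2.
apply/polyP => i; rewrite coefZ coefXn; apply: (@intr_inj R).
by rewrite -ev b0 !mul0r !add0r intrM -e2; case: (i == 2).
Qed.

(** * The set without common return times *)

Lemma normT_le {R : realType} (x : R) (m : int) : normT x <= `|x - m%:~R|.
Proof. by have [k [-> km]] := normT_min x; exact: km. Qed.

Lemma closest_integer_err {R : realType} (rnd : R -> int) (x : R) :
  is_closest_integer rnd -> `|x - (rnd x)%:~R| <= 1 / 2.
Proof.
move=> rndP; have [f1 f2] := floor_le_lt x.
have := rndP x (Num.floor x); have := rndP x (Num.floor x + 1).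
rewrite intrD (ger0_norm (x := x - (Num.floor x)%:~R)) ?subr_ge0//.
by rewrite (ler0_norm (x := x - (_ + _))); lra.
Qed.

Lemma density_set_small_differences {R : realType} (lambda eps : R) (L : nat) :
  irrational lambda -> 0 < eps <= 1 -> (0 < L)%N ->
  exists E : set nat,
    [/\ E `<=` posnat, exists d : R, 0 < d /\ has_natural_density E d
      & forall (r : int) e e', E e -> E e' -> e%:Z = e'%:Z + r ->
          exists u w : int, r = L%:Z * u /\ `|u%:~R * lambda - w%:~R| < eps].
Proof.
move=> lirr /andP[eps0 eps1] L0.
have [j [p [j0 /andP[jp0 jpe]]]] := Dirichlet_approximation lambda eps lirr eps0.
(* An arc length must be positive: if [j lambda - p] is negative, rotate by [- lambda] instead. *)
have [mu [q [mul q0 qe]]] : exists (mu : R) (q : int),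
    [/\ mu = lambda \/ mu = - lambda, 0 < j%:R * mu - q%:~R
      & j%:R * mu - q%:~R < eps].
  have [lt|ge] := ltP 0 (j%:R * lambda - p%:~R).
    by exists lambda, p; split; [left| |rewrite gtr0_norm in jpe].
  exists (- lambda), (- p); split; [by right| |].
    by rewrite ler0_norm// in jp0; rewrite intrN; lra.
  by rewrite ler0_norm// in jpe; rewrite intrN; lra.
have L0' : 0 < L%:R :> R by rewrite ltr0n.
exists (dilated_return_times L mu j q); split.
- by move=> m /and3P[].
- exists ((j%:R * mu - q%:~R) / L%:R); split; first exact: divr_gt0.
  by apply: natural_density_dilated_return_times => //; apply/andP; split; lra.
- move=> r e e' /and3P[_ Le re] /and3P[_ Le' re'] er.
  have [w wP] := return_times_diff _ _ _ _ _ re re'.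
  have rE : r = L%:Z * ((e %/ L)%N%:Z - (e' %/ L)%N%:Z).
    rewrite mulrBr -!PoszM ![(L * _)%N]mulnC !divnK// er.
    by ring.
  case: mul => muE; exists ((e %/ L)%N%:Z - (e' %/ L)%N%:Z).
    by exists w; split=> //; rewrite intrB -!pmulrn -muE; lra.
  exists (- w); split=> //; rewrite intrB -!pmulrn intrN -normrN.
  have -> : - (((e %/ L)%:R - (e' %/ L)%:R) * lambda - - w%:~R) =
    ((e %/ L)%:R - (e' %/ L)%:R) * mu - w%:~R by rewrite muE; ring.
  by lra.
Qed.

Theorem theorem1p7 (R : realType) (rnd : R -> int)
    (rndP : is_closest_integer rnd)
    (lambda : R) (lambda_irr : irrational lambda)
    (L : nat) (L_gt0 : (0 < L)%N)
    (L_large : 1 + `|lambda| < L%:R * normT (Num.sqrt 2 : R)) :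
  [/\ PZ [tuple (@h1 R); h2 lambda L; (@h3 R)] =
        [set q : {poly int} | exists c : int, c != 0 /\ q = c *: 'X^2],
      jointly_intersective (PZ [tuple (@h1 R); h2 lambda L; (@h3 R)])
    & exists E : set nat,
        [/\ E `<=` posnat,
            exists d : R, 0 < d /\ has_natural_density E d
          & return_set rnd (@h1 R) E `&` return_set rnd (h2 lambda L) E
              `&` return_set rnd (@h3 R) E = set0]].
Proof.
have PZE := PZ_h1_h2_h3 lambda L L_gt0.
split=> //.
  rewrite PZE => m m0; exists m; split=> // _ [c [_ ->]].
  by rewrite hornerZ hornerXn expr2 mulrA modzMl mod0z.
have L0 : 0 < L%:R :> R by rewrite ltr0n.
have nT0 : 0 < normT (Num.sqrt 2 : R).
  by have := normr_ge0 lambda => ?; rewrite -(pmulr_rgt0 _ L0); lra.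
have nT1 : normT (Num.sqrt 2 : R) <= 1.
  have [f1 f2] := floor_le_lt (Num.sqrt 2 : R).
  apply: le_trans (normT_le _ (Num.floor (Num.sqrt 2 : R))) _.
  by rewrite ger0_norm; lra.
have [|E [Epos Ed Ediff]] :=
  (* Rounding errors cost at most [(1 + |lambda|) / 2], less than half of [L * normT (Num.sqrt 2)];
     the other half is left for the arc. *)
  density_set_small_differences lambda (normT (Num.sqrt 2) / 2) L lambda_irr _ L_gt0.
  by apply/andP; split; lra.
exists E; split=> //; apply/seteqP; split=> // n [[[n0 [m [Em [_ [e Ee er]]]]]]].
move=> [_ [m' [Em' [_ [e' Ee' er']]]]] _.
have [u1 [w1 [r1 u1w]]] := Ediff _ _ _ Ee Em er.
have [u2 [w2 [r2 _]]] := Ediff _ _ _ Ee' Em' er'.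
have e1P := closest_integer_err rnd (h1 n%:R) rndP.
have e2P := closest_integer_err rnd (h2 lambda L n%:R) rndP.
move: e1P e2P; rewrite r1 r2 !intrM -!pmulrn /h1 /h2.
set T := n%:R `^ _; set s := Num.sqrt 2 in nT0 nT1 u1w L_large *.
set e1 := T - _; set e2 := _ + _ - _ => e1P e2P.
(* Forming [e2 - lambda * e1] cancels [T]; replacing [u1 lambda] by its nearby integer [w1] then
   exhibits an integer too close to [s]. *)
have sE : L%:R * (s - (u2 - n%:Z - w1)%:~R) =
    L%:R * (w1%:~R - u1%:~R * lambda) + (e2 - lambda * e1).
  by rewrite !intrB -pmulrn /e1 /e2; ring.
have : L%:R * normT s <= L%:R * `|u1%:~R * lambda - w1%:~R| + (1 + `|lambda|) / 2.
  apply: le_trans (_ : L%:R * `|s - (u2 - n%:Z - w1)%:~R| <= _).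
    by rewrite ler_pM2l// normT_le.
  rewrite -[X in X * `|_| <= _](gtr0_norm L0) -normrM sE.
  apply: le_trans (ler_normD _ _) _; rewrite normrM (gtr0_norm L0).
  rewrite distrC lerD2l; apply: le_trans (ler_normB _ _) _; rewrite normrM.
  by have := normr_ge0 lambda; nra.
by nra.
Qed.
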